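(* Let $\omega$ be a circle with center $O$ and $\xi$ an ellipse with center $O$ lying inside $\omega$. Let $(u_1,\dots,u_n)$ be a Poncelet $n$-gon for the pair $(\omega,\xi)$. Then for each $k$, $\sum_{i=1}^n\cos\angle u_iOu_{i+k}$ is constant in the Poncelet family of $n$-gons containing $(u_1,\dots,u_n)$.
   Context: Indices are mod $n$. A Poncelet $n$-gon for a pair of conics $(C,D)$, $D$ inside $C$, is a closed polygon with all vertices on $C$ and all sides tangent to $D$. By the Poncelet porism, if one such closed $n$-gon exists, then starting from any point of $C$ and successively drawing tangent lines to $D$ (in the same rotational sense) produces a closed $n$-gon; the Poncelet family is this continuous 1-parameter family. $\angle u_iOu_{i+k}\in[0,\pi]$ is the angle between the vectors $u_i-O$ and $u_{i+k}-O$. *)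

(* Defs.v *)
From Stdlib Require Import Reals Lra List.
Open Scope R_scope.

Definition pt := (R * R)%type.

Definition vsub (p q : pt) : pt := (fst p - fst q, snd p - snd q).
Definition dot (p q : pt) : R := fst p * fst q + snd p * snd q.
Definition cross (p q : pt) : R := fst p * snd q - snd p * fst q.
Definition vnorm (p : pt) : R := sqrt (dot p p).

Definition angle (p O q : pt) : R :=
  acos (dot (vsub p O) (vsub q O) / (vnorm (vsub p O) * vnorm (vsub q O))).

Definition on_circle (O : pt) (r : R) (x : pt) : Prop :=
  dot (vsub x O) (vsub x O) = r ^ 2.

(* Ellipse with center O:  a X^2 + 2 b X Y + c Y^2 = 1  (X,Y) = x - O,
   where the quadratic form is positive definite. *)
Definition is_ellipse_param (a b c : R) : Prop := 0 < a /\ a * c - b ^ 2 > 0.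

Definition on_ellipse (O : pt) (a b c : R) (x : pt) : Prop :=
  let X := fst (vsub x O) in let Y := snd (vsub x O) in
  a * X ^ 2 + 2 * b * X * Y + c * Y ^ 2 = 1.

Definition ellipse_inside_circle (O : pt) (r a b c : R) : Prop :=
  forall x, on_ellipse O a b c x -> dot (vsub x O) (vsub x O) < r ^ 2.

Definition on_line (p q x : pt) : Prop := cross (vsub q p) (vsub x p) = 0.

(* The line through the distinct points p, q is tangent to the ellipse:
   it meets the (convex) ellipse in exactly one point. *)
Definition tangent_to_ellipse (O : pt) (a b c : R) (p q : pt) : Prop :=
  p <> q /\ exists! x, on_ellipse O a b c x /\ on_line p q x.

Definition side_sense (O : pt) (u : nat -> pt) (i : nat) : R :=
  cross (vsub (u i) O) (vsub (u (S i)) O).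

(* A closed Poncelet n-gon for (circle(O,r), ellipse(O,a,b,c)), indices mod n
   encoded by n-periodicity of u : nat -> pt. *)
Definition poncelet_ngon (n : nat) (O : pt) (r a b c : R) (u : nat -> pt) : Prop :=
  (forall i, u (i + n)%nat = u i) /\
  (forall i, on_circle O r (u i)) /\
  (forall i, tangent_to_ellipse O a b c (u i) (u (S i))).

Definition same_sense (O : pt) (u v : nat -> pt) : Prop :=
  ((forall i, 0 < side_sense O u i) /\ (forall i, 0 < side_sense O v i)) \/
  ((forall i, side_sense O u i < 0) /\ (forall i, side_sense O v i < 0)).

Definition rsum (n : nat) (f : nat -> R) : R :=
  fold_right Rplus 0 (map f (seq 0 n)).

Definition cos_sum (n k : nat) (O : pt) (u : nat -> pt) : R :=
  rsum n (fun i => cos (angle (u i) O (u (i + k)%nat))).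

(* Main.v *)
Require Import Defs.
From Stdlib Require Import Reals Lra Lia List Ranalysis5.
From Coquelicot Require Import Coquelicot.
Open Scope R_scope.

(** In coordinates where the circle is the unit circle and the axes are those of the
    ellipse, the tangency of the chord pq reads [p1 q1 + D p2 q2 = C] with [0 < D <= 1]
    and [|C| < D].  This is the relation between [(cn z, sn z)] and [(cn (z+s), sn (z+s))]
    for the Jacobi functions of squared modulus [m = (1-D^2)/(1-C^2)], where [cn s = C] and
    [dn s = D]; so the vertices are the points of parameters [z0 + i s], and only [z0]
    varies in the family.  For the shift [t = k s] the same relation gives
      [cos (u_i O u_(i+k)) = cn t + (1 - dn t) sn z_i sn z_(i+k)],
    and by [m sn t sn z sn (z+t) = eps t + eps z - eps (z+t)], where [eps] is the primitive
    of [dn^2], the sum of the products telescopes to [(n eps t - k eps (n s)) / (m sn t)],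
    because [n s] is a period of [dn]. *)

(** * Jacobi elliptic functions: subtraction formulas and periods *)

(** Everything the argument uses about these functions, kept apart from their construction. [eps] is
    Jacobi's epsilon function, the elliptic integral of the second kind as a function of the
    argument. *)
Record jacobi (m : R) (sn cn dn eps : R -> R) : Prop := {
  sn_derive : forall z, is_derive sn z (cn z * dn z);
  cn_derive : forall z, is_derive cn z (- (sn z * dn z));
  dn_derive : forall z, is_derive dn z (- (m * sn z * cn z));
  eps_derive : forall z, is_derive eps z (dn z ^ 2);
  sn_0 : sn 0 = 0;
  cn_0 : cn 0 = 1;
  eps_0 : eps 0 = 0;
  cn_sqr : forall z, cn z ^ 2 = 1 - sn z ^ 2;
  dn_sqr : forall z, dn z ^ 2 = 1 - m * sn z ^ 2;
  dn_pos : forall z, 0 < dn z;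
  jacobi_surj : forall x y, x ^ 2 + y ^ 2 = 1 -> exists z, cn z = x /\ sn z = y
}.

Lemma derive_0_const (f : R -> R) (x : R) :
  (forall t, is_derive f t 0) -> f x = f 0.
Proof.
  intros H.
  destruct (Rtotal_order x 0) as [h | [-> | h]]; [ | reflexivity | ].
  - apply eq_is_derive; [intros; apply H | exact h].
  - symmetry; apply eq_is_derive; [intros; apply H | exact h].
Qed.

(** The quotient [f / g] has derivative zero; cross-multiplied form suits identities with a common
    denominator. *)
Lemma quotient_const (f g : R -> R) (x : R) :
  (forall t, g t <> 0) ->
  (forall t, exists f' g', is_derive f t f' /\ is_derive g t g' /\ f' * g t = f t * g') ->
  f x * g 0 = f 0 * g x.
Proof.
  intros Hg H.
  assert (E : f x / g x = f 0 / g 0).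
  { apply (derive_0_const (fun t => f t / g t)); intros t.
    destruct (H t) as (f' & g' & Hf' & Hg' & e).
    replace 0 with ((f' * g t - f t * g') / g t ^ 2).
    - apply (is_derive_div f g); auto.
    - rewrite e; field; apply Hg. }
  pose proof (Hg x); pose proof (Hg 0).
  replace (f x) with (f x / g x * g x) by (field; assumption).
  rewrite E; field; assumption.
Qed.

Section Jacobi.

Variables (m : R) (sn cn dn eps : R -> R).
Hypotheses (m_ge0 : 0 <= m) (m_lt1 : m < 1) (J : jacobi m sn cn dn eps).

Let sn' z := is_derive_unique _ _ _ (sn_derive _ _ _ _ _ J z).
Let cn' z := is_derive_unique _ _ _ (cn_derive _ _ _ _ _ J z).
Let dn' z := is_derive_unique _ _ _ (dn_derive _ _ _ _ _ J z).
Let eps' z := is_derive_unique _ _ _ (eps_derive _ _ _ _ _ J z).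
Let csq := cn_sqr _ _ _ _ _ J.
Let dsq := dn_sqr _ _ _ _ _ J.

(** Both squares of [sn] are at most 1 and [m < 1]. This is the common denominator of the formulas
    below. *)
Lemma jacobi_denom_pos (x y : R) : 0 < 1 - m * sn x ^ 2 * sn y ^ 2.
Proof.
  pose proof (csq x); pose proof (csq y).
  pose proof (pow2_ge_0 (sn x)); pose proof (pow2_ge_0 (sn y)).
  pose proof (pow2_ge_0 (cn x)); pose proof (pow2_ge_0 (cn y)).
  assert (sn x ^ 2 * sn y ^ 2 <= 1) by nra.
  assert (0 <= sn x ^ 2 * sn y ^ 2) by nra.
  nra.
Qed.

Lemma dn_0 : dn 0 = 1.
Proof.
  pose proof (dsq 0) as H; rewrite (sn_0 _ _ _ _ _ J) in H.
  pose proof (dn_pos _ _ _ _ _ J 0); nra.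
Qed.

Ltac jacobi_derive :=
  auto_derive;
  [ repeat split; eexists;
    lazymatch goal with
    | |- context [sn] => apply (sn_derive _ _ _ _ _ J)
    | |- context [cn] => apply (cn_derive _ _ _ _ _ J)
    | |- context [dn] => apply (dn_derive _ _ _ _ _ J)
    | |- context [eps] => apply (eps_derive _ _ _ _ _ J)
    end
  | rewrite ?sn', ?cn', ?dn', ?eps' ].

Ltac jacobi_ring x y :=
  let H1 := fresh in let H2 := fresh in let H3 := fresh in let H4 := fresh in
  pose proof (csq x) as H1; pose proof (csq y) as H2;
  pose proof (dsq x) as H3; pose proof (dsq y) as H4;
  ring [H1 H2 H3 H4].

(** Subtraction formula for [s = (z + s) - z]. With [s] fixed, the right side over the denominator
    has derivative zero in [z], and at [z = 0] it is [sn s]. The formulas for [cn] and [dn] follow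
    in the same way. *)
Lemma sn_diff (s z : R) :
  sn s * (1 - m * sn z ^ 2 * sn (z + s) ^ 2)
  = sn (z + s) * cn z * dn z - sn z * cn (z + s) * dn (z + s).
Proof.
  pose (num z := sn (z + s) * cn z * dn z - sn z * cn (z + s) * dn (z + s)).
  pose (den z := 1 - m * sn z ^ 2 * sn (z + s) ^ 2).
  assert (H : num z * den 0 = num 0 * den z).
  { apply quotient_const; intros t; unfold num, den.
    - apply Rgt_not_eq, jacobi_denom_pos.
    - do 2 eexists; refine (conj _ (conj _ _)); [ jacobi_derive; reflexivity .. | ].
      jacobi_ring t (t + s). }
  unfold num, den in H.
  rewrite ?Rplus_0_l, (sn_0 _ _ _ _ _ J), ?(cn_0 _ _ _ _ _ J), ?dn_0 in H.
  lra.
Qed.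

Lemma cn_diff (s z : R) :
  cn s * (1 - m * sn z ^ 2 * sn (z + s) ^ 2)
  = cn (z + s) * cn z + sn z * sn (z + s) * dn z * dn (z + s).
Proof.
  pose (num z := cn (z + s) * cn z + sn z * sn (z + s) * dn z * dn (z + s)).
  pose (den z := 1 - m * sn z ^ 2 * sn (z + s) ^ 2).
  assert (H : num z * den 0 = num 0 * den z).
  { apply quotient_const; intros t; unfold num, den.
    - apply Rgt_not_eq, jacobi_denom_pos.
    - do 2 eexists; refine (conj _ (conj _ _)); [ jacobi_derive; reflexivity .. | ].
      jacobi_ring t (t + s). }
  unfold num, den in H.
  rewrite ?Rplus_0_l, (sn_0 _ _ _ _ _ J), ?(cn_0 _ _ _ _ _ J), ?dn_0 in H.
  lra.
Qed.

Lemma dn_diff (s z : R) :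
  dn s * (1 - m * sn z ^ 2 * sn (z + s) ^ 2)
  = dn (z + s) * dn z + m * sn z * sn (z + s) * cn z * cn (z + s).
Proof.
  pose (num z := dn (z + s) * dn z + m * sn z * sn (z + s) * cn z * cn (z + s)).
  pose (den z := 1 - m * sn z ^ 2 * sn (z + s) ^ 2).
  assert (H : num z * den 0 = num 0 * den z).
  { apply quotient_const; intros t; unfold num, den.
    - apply Rgt_not_eq, jacobi_denom_pos.
    - do 2 eexists; refine (conj _ (conj _ _)); [ jacobi_derive; reflexivity .. | ].
      jacobi_ring t (t + s). }
  unfold num, den in H.
  rewrite ?Rplus_0_l, (sn_0 _ _ _ _ _ J), ?(cn_0 _ _ _ _ _ J), ?dn_0 in H.
  lra.
Qed.

(** After multiplication by the denominator, the [m]-term of [dn_diff] cancels the non-constant part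
    of the denominator, and [cn_diff] remains. *)
Lemma jacobi_bilinear (s z : R) :
  cn z * cn (z + s) + dn s * (sn z * sn (z + s)) = cn s.
Proof.
  pose proof (jacobi_denom_pos z (z + s)).
  pose proof (cn_diff s z) as Hc; pose proof (dn_diff s z) as Hd.
  apply Rmult_eq_reg_r with (1 - m * sn z ^ 2 * sn (z + s) ^ 2); [ | lra ].
  rewrite Hc, Rmult_plus_distr_r.
  replace (dn s * (sn z * sn (z + s)) * (1 - m * sn z ^ 2 * sn (z + s) ^ 2))
    with (sn z * sn (z + s) * (dn s * (1 - m * sn z ^ 2 * sn (z + s) ^ 2))) by ring.
  rewrite Hd; ring.
Qed.

(** Since [dn z > 0], the left side has the sign of [sn s] for every [z]: a shift by [s] always
    turns in the same sense. *)
Lemma jacobi_cross (s z : R) :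
  cn z * sn (z + s) - dn s * (sn z * cn (z + s)) = dn z * sn s.
Proof.
  pose proof (jacobi_denom_pos z (z + s)).
  pose proof (sn_diff s z) as Hs; pose proof (dn_diff s z) as Hd.
  apply Rmult_eq_reg_r with (1 - m * sn z ^ 2 * sn (z + s) ^ 2); [ | lra ].
  rewrite Rmult_assoc with (r1 := dn z), Hs.
  replace ((cn z * sn (z + s) - dn s * (sn z * cn (z + s)))
           * (1 - m * sn z ^ 2 * sn (z + s) ^ 2))
    with (cn z * sn (z + s) * (1 - m * sn z ^ 2 * sn (z + s) ^ 2) - sn z * cn (z + s)
          * (dn s * (1 - m * sn z ^ 2 * sn (z + s) ^ 2))) by ring.
  rewrite Hd.
  jacobi_ring z (z + s).
Qed.

(** Both sides agree at [z = 0]; by [sn_diff] they have the same derivative in [z], the numerator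
    there being one factor of a difference of squares. *)
Lemma eps_diff (s z : R) :
  m * sn s * (sn z * sn (z + s)) = eps s + eps z - eps (z + s).
Proof.
  pose (f z := m * sn s * (sn z * sn (z + s)) - eps z + eps (z + s)).
  assert (H : f z = f 0).
  { apply derive_0_const; intros t; unfold f; jacobi_derive.
    pose proof (jacobi_denom_pos t (t + s)).
    pose proof (sn_diff s t) as Hs.
    apply Rmult_eq_reg_r with (1 - m * sn t ^ 2 * sn (t + s) ^ 2); [ | lra ].
    transitivity (m * (sn s * (1 - m * sn t ^ 2 * sn (t + s) ^ 2))
                  * (cn t * dn t * sn (t + s) + sn t * cn (t + s) * dn (t + s))
                  + (dn (t + s) ^ 2 - dn t ^ 2) * (1 - m * sn t ^ 2 * sn (t + s) ^ 2)).
    - ring.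
    - rewrite Hs.
      jacobi_ring t (t + s). }
  unfold f in H.
  rewrite Rplus_0_l, (sn_0 _ _ _ _ _ J), (eps_0 _ _ _ _ _ J) in H; lra.
Qed.

(** One coincidence forces [cn S = dn S = 1]. Then [jacobi_bilinear] says that the unit vectors at
    [z] and [z + S] have inner product 1, so they are equal. *)
Lemma jacobi_period (S z0 : R) :
  sn (z0 + S) = sn z0 -> cn (z0 + S) = cn z0 -> forall z, sn (z + S) = sn z.
Proof.
  intros Hs Hc z.
  pose proof (jacobi_denom_pos z0 z0) as Hp.
  assert (Hd : dn (z0 + S) = dn z0).
  { pose proof (dn_pos _ _ _ _ _ J z0); pose proof (dn_pos _ _ _ _ _ J (z0 + S)).
    pose proof (dsq z0); pose proof (dsq (z0 + S)) as H2; rewrite Hs in H2; nra. }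
  assert (cS : cn S = 1).
  { pose proof (cn_diff S z0) as H; rewrite Hs, Hc, Hd in H.
    apply Rmult_eq_reg_r with (1 - m * sn z0 ^ 2 * sn z0 ^ 2); [ | lra ].
    rewrite H; jacobi_ring z0 z0. }
  assert (dS : dn S = 1).
  { pose proof (dn_diff S z0) as H; rewrite Hs, Hc, Hd in H.
    apply Rmult_eq_reg_r with (1 - m * sn z0 ^ 2 * sn z0 ^ 2); [ | lra ].
    rewrite H; jacobi_ring z0 z0. }
  pose proof (jacobi_bilinear S z) as H; rewrite cS, dS in H.
  pose proof (csq z); pose proof (csq (z + S)).
  assert ((sn (z + S) - sn z) ^ 2 + (cn (z + S) - cn z) ^ 2 = 0) by nra.
  pose proof (pow2_ge_0 (sn (z + S) - sn z)).
  pose proof (pow2_ge_0 (cn (z + S) - cn z)).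
  assert ((sn (z + S) - sn z) ^ 2 = 0) by lra.
  apply Rminus_diag_uniq; destruct (Req_dec (sn (z + S) - sn z) 0) as [|n]; [easy|].
  apply (pow_nonzero _ 2) in n; lra.
Qed.

(** The derivative [dn^2] of [eps] has period [S], so the increment over [S] is constant. *)
Lemma eps_period (S z0 : R) :
  sn (z0 + S) = sn z0 -> cn (z0 + S) = cn z0 -> forall z, eps (z + S) = eps z + eps S.
Proof.
  intros Hs Hc z.
  pose (f z := eps (z + S) - eps z).
  assert (H : f z = f 0).
  { apply derive_0_const; intros t; unfold f; jacobi_derive.
    pose proof (jacobi_period S z0 Hs Hc t) as e.
    pose proof (dsq (t + S)) as H1; rewrite e, <- dsq in H1; lra. }
  unfold f in H; rewrite Rplus_0_l, (eps_0 _ _ _ _ _ J) in H; lra.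
Qed.

End Jacobi.

(** * Construction of the Jacobi functions by inverting an elliptic integral *)

Lemma unit_polar (x y : R) : x ^ 2 + y ^ 2 = 1 -> exists t, cos t = x /\ sin t = y.
Proof.
  intros H.
  assert (-1 <= x <= 1) by nra.
  assert (Hs : sin (acos x) ^ 2 = y ^ 2).
  { pose proof (sin2_cos2 (acos x)) as e; rewrite cos_acos in e by assumption.
    unfold Rsqr in e; lra. }
  destruct (Req_dec (sin (acos x)) y) as [e | ne].
  - exists (acos x); rewrite cos_acos; auto.
  - exists (- acos x); rewrite cos_neg, sin_neg, cos_acos by assumption; split; [easy|].
    apply (Rmult_eq_reg_l (sin (acos x) - y)); nra.
Qed.

Section Amplitude.

Variable m : R.
Hypotheses (m_ge0 : 0 <= m) (m_lt1 : m < 1).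

(** [F] is the incomplete elliptic integral of the first kind, and [w] is [dn] as a function of the
    amplitude. *)
Let w (t : R) := sqrt (1 - m * sin t ^ 2).
Let F (t : R) : R := RInt (fun t => / w t) 0 t.

Lemma radicand_bounds (t : R) : 0 < 1 - m * sin t ^ 2 <= 1.
Proof.
  pose proof (sin2_cos2 t) as e; unfold Rsqr in e.
  pose proof (pow2_ge_0 (sin t)); pose proof (pow2_ge_0 (cos t)); nra.
Qed.

Let w_pos (t : R) : 0 < w t.
Proof. apply sqrt_lt_R0, radicand_bounds. Qed.

Let w_sqr (t : R) : w t ^ 2 = 1 - m * sin t ^ 2.
Proof. apply pow2_sqrt; destruct (radicand_bounds t); lra. Qed.

Let w_derive (t : R) : is_derive w t (- (m * sin t * cos t) / w t).
Proof.
  unfold w; auto_derive.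
  - destruct (radicand_bounds t); simpl in *; lra.
  - pose proof (w_pos t) as H; unfold w in H.
    replace (1 + - (m * (sin t * (sin t * 1)))) with (1 - m * sin t ^ 2) by ring.
    field; lra.
Qed.

Let F_derive (t : R) : is_derive F t (/ w t).
Proof.
  assert (cont : forall t, continuous (fun t => / w t) t).
  { intros x; apply (ex_derive_continuous (fun t => / w t)).
    eexists; apply is_derive_inv; [ apply w_derive | apply Rgt_not_eq, w_pos ]. }
  apply (is_derive_RInt (fun t => / w t) F 0); [ | apply cont ].
  apply filter_forall; intros b.
  apply (RInt_correct (fun t => / w t)), ex_RInt_continuous; intros; apply cont.
Qed.

Let F_0 : F 0 = 0.
Proof. exact (RInt_point 0 (fun t => / w t)). Qed.

(** The integrand is at least 1. Hence [F] is injective and unbounded on both sides, and its inverse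
    is 1-Lipschitz. *)
Let F_expands (x y : R) : x <= y -> y - x <= F y - F x.
Proof.
  intros Hxy.
  destruct (MVT_gen F x y (fun t => / w t)) as (c & _ & e).
  - intros; apply F_derive.
  - intros t _; apply continuity_pt_filterlim, (ex_derive_continuous F).
    eexists; apply F_derive.
  - rewrite e.
    assert (1 <= / w c).
    { rewrite <- Rinv_1 at 1; apply Rinv_le_contravar; [ apply w_pos | ].
      unfold w; rewrite <- sqrt_1 at 2; apply sqrt_le_1_alt, radicand_bounds. }
    nra.
Qed.

Let F_surj (z : R) : {t | F t = z}.
Proof.
  destruct (IVT_gen F (- Rabs z) (Rabs z) z) as (t & _ & e); [ | | now exists t ].
  - intros t; apply continuity_pt_filterlim, (ex_derive_continuous F).
    eexists; apply F_derive.
  - pose proof (Rabs_pos z); pose proof (Rle_abs z); pose proof (Rle_abs (- z)) as h.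
    rewrite Rabs_Ropp in h.
    pose proof (F_expands 0 (Rabs z)); pose proof (F_expands (- Rabs z) 0).
    rewrite F_0 in *.
    split; [ eapply Rle_trans; [ apply Rmin_l | lra ]
           | eapply Rle_trans; [ | apply Rmax_r ]; lra ].
Qed.

(** The Jacobi amplitude, inverse to [F]. *)
Let am (z : R) : R := proj1_sig (F_surj z).

Let F_am (z : R) : F (am z) = z.
Proof. unfold am; destruct (F_surj z); assumption. Qed.

Let am_F (t : R) : am (F t) = t.
Proof.
  pose proof (F_am (F t)) as e.
  destruct (Rle_dec (am (F t)) t) as [h | h].
  - pose proof (F_expands _ _ h); lra.
  - assert (h' : t <= am (F t)) by lra.
    pose proof (F_expands _ _ h'); lra.
Qed.

Let am_monotone (x y : R) : x <= y -> am x <= am y <= am x + (y - x).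
Proof.
  intros h.
  destruct (Rle_dec (am x) (am y)) as [h' | h'].
  - pose proof (F_expands _ _ h') as H; rewrite !F_am in H; lra.
  - assert (h'' : am y <= am x) by lra.
    pose proof (F_expands _ _ h'') as H; rewrite !F_am in H; lra.
Qed.

Let am_continuous (z : R) : continuity_pt am z.
Proof.
  intros e he; exists e; split; [ exact he | ].
  intros x [_ hx]; unfold dist, R_met, R_dist in *; simpl in *.
  destruct (Rle_dec x z) as [h | h].
  - pose proof (am_monotone _ _ h); rewrite Rabs_left1 in * by lra; lra.
  - assert (h' : z <= x) by lra; pose proof (am_monotone _ _ h').
    rewrite Rabs_pos_eq in * by lra; lra.
Qed.

Let am_derive (z : R) : is_derive am z (w (am z)).
Proof.
  assert (Prf : forall a, derivable_pt F a).
  { intros a; exists (/ w a); apply is_derive_Reals, F_derive. }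
  assert (D : forall a pr, derive_pt F a pr = / w a).
  { intros a pr; apply derive_pt_eq_0, is_derive_Reals, F_derive. }
  apply is_derive_Reals.
  assert (Hi : am (z - 1) <= am z <= am (z + 1)).
  { split; apply am_monotone; lra. }
  pose proof (derivable_pt_lim_recip_interv F am (z - 1) (z + 1) z (fun a _ => Prf a)
    (am_continuous z) ltac:(lra) ltac:(lra) Hi (fun x _ => F_am x)) as H.
  cbv beta in H; rewrite D in H.
  replace (w (am z)) with (1 / / w (am z)).
  - apply H, Rinv_neq_0_compat, Rgt_not_eq, w_pos.
  - field; apply Rgt_not_eq, w_pos.
Qed.

(** The classical formulas [sn = sin am], [cn = cos am], [dn = w am]; surjectivity onto the unit
    circle comes from polar angles, since [am (F t) = t]. *)
Lemma jacobi_exists : exists sn cn dn eps, jacobi m sn cn dn eps.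
Proof.
  assert (am_0 : am 0 = 0) by (rewrite <- F_0 at 1; apply am_F).
  assert (cont : forall z, continuous (fun z => w (am z) ^ 2) z).
  { intros z; apply (ex_derive_continuous (fun z => w (am z) ^ 2)).
    auto_derive; repeat split; eexists; [ apply w_derive | apply am_derive ]. }
  exists (fun z => sin (am z)), (fun z => cos (am z)), (fun z => w (am z)),
    (fun z => RInt (fun z => w (am z) ^ 2) 0 z).
  assert (am' := fun z => is_derive_unique _ _ _ (am_derive z)).
  assert (w' := fun z => is_derive_unique _ _ _ (w_derive z)).
  split.
  - intros z; auto_derive; [ eexists; apply am_derive | rewrite am'; ring ].
  - intros z; auto_derive; [ eexists; apply am_derive | rewrite am'; ring ].
  - intros z; auto_derive; [ repeat split; eexists; [ apply w_derive | apply am_derive ] | ].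
    rewrite am', w'; field; apply Rgt_not_eq, w_pos.
  - intros z.
    apply (is_derive_RInt (fun z => w (am z) ^ 2) _ 0); [ | apply cont ].
    apply filter_forall; intros b.
    apply (RInt_correct (fun z => w (am z) ^ 2)), ex_RInt_continuous; intros; apply cont.
  - rewrite am_0; apply sin_0.
  - rewrite am_0; apply cos_0.
  - exact (RInt_point 0 (fun z => w (am z) ^ 2)).
  - intros z; pose proof (sin2_cos2 (am z)) as e; unfold Rsqr in e; lra.
  - intros z; apply w_sqr.
  - intros z; apply w_pos.
  - intros x y H; destruct (unit_polar x y H) as (t & hc & hs).
    exists (F t); rewrite am_F; auto.
Qed.

End Amplitude.

(** * Finite sums and telescoping *)

Lemma rsum_S (n : nat) (f : nat -> R) : rsum (S n) f = rsum n f + f n.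
Proof.
  unfold rsum; rewrite seq_S, map_app, fold_right_app; simpl.
  generalize (map f (seq 0 n)) as l; induction l as [|x l IH]; simpl; lra.
Qed.

Lemma rsum_ext (n : nat) (f g : nat -> R) :
  (forall i, f i = g i) -> rsum n f = rsum n g.
Proof. intros H; unfold rsum; f_equal; apply map_ext, H. Qed.

Lemma rsum_affine (n : nat) (a b : R) (f : nat -> R) :
  rsum n (fun i => a + b * f i) = INR n * a + b * rsum n f.
Proof.
  induction n as [|n IH]; [ unfold rsum; simpl; ring | ].
  rewrite !rsum_S, IH, S_INR; ring.
Qed.

Lemma rsum_plus (n : nat) (f g : nat -> R) :
  rsum n (fun i => f i + g i) = rsum n f + rsum n g.
Proof.
  induction n as [|n IH]; [ unfold rsum; simpl; ring | ].
  rewrite !rsum_S, IH; ring.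
Qed.

Lemma rsum_telescope (n : nat) (f : nat -> R) :
  rsum n (fun i => f (S i) - f i) = f n - f 0%nat.
Proof.
  induction n as [|n IH]; [ unfold rsum; simpl; ring | ].
  rewrite rsum_S, IH; ring.
Qed.

(** Each unit shift of the window of length [n] changes the sum by [g (n + k) - g k = P]. *)
Lemma rsum_shift_quasiperiodic (n k : nat) (g : nat -> R) (P : R) :
  (forall i, g (i + n)%nat = g i + P) ->
  rsum n (fun i => g (i + k)%nat - g i) = INR k * P.
Proof.
  intros Hg; induction k as [|k IH].
  - rewrite (rsum_ext n _ (fun i => 0 + 0 * g i)).
    + rewrite rsum_affine; simpl; ring.
    + intros i; rewrite Nat.add_0_r; ring.
  - rewrite (rsum_ext n _ (fun i => (g (i + k)%nat - g i)
                                   + (g (S i + k)%nat - g (i + k)%nat))).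
    + rewrite rsum_plus, IH, (rsum_telescope n (fun i => g (i + k)%nat)).
      simpl Nat.add; rewrite (Nat.add_comm n k), Hg, S_INR; ring.
    + intros i; replace (S i + k)%nat with (i + S k)%nat by lia; ring.
Qed.

(** * The cosine sum for polygons in normalised coordinates *)

(* The line [{q | x q1 + D y q2 = C}] separates [(x, y)] from its antipode, so it meets
   each of the two half circles they bound once; [x q2 - D y q1] has constant
   absolute value on these two points, and its sign tells them apart. *)
Lemma half_circle_unique (C D e x y X Y X' Y' : R) :
  0 < D <= 1 -> C ^ 2 < D ^ 2 -> e ^ 2 = 1 ->
  x ^ 2 + y ^ 2 = 1 -> X ^ 2 + Y ^ 2 = 1 -> X' ^ 2 + Y' ^ 2 = 1 ->
  x * X + D * (y * Y) = C -> x * X' + D * (y * Y') = C ->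
  0 < e * (x * Y - y * X) -> 0 < e * (x * Y' - D * (y * X')) ->
  X = X' /\ Y = Y'.
Proof.
  intros [HD HD1] HC He Hp Hq Hq' Hl Hl' Hs Hs'.
  pose (N := x ^ 2 + (D * y) ^ 2).
  pose (t := x ^ 2 + D * y ^ 2).
  assert (Ht : D <= t) by (unfold t; nra).
  assert (Ht2 : D ^ 2 <= t ^ 2) by nra.
  pose (w := x * Y - D * (y * X)); pose (w' := x * Y' - D * (y * X')).
  fold w' in Hs'.
  assert (Hw : w ^ 2 = N - C ^ 2).
  { transitivity (N * (X ^ 2 + Y ^ 2) - (x * X + D * (y * Y)) ^ 2).
    - unfold w, N; ring.
    - rewrite Hq, Hl; ring. }
  assert (Hw' : w' ^ 2 = N - C ^ 2).
  { transitivity (N * (X' ^ 2 + Y' ^ 2) - (x * X' + D * (y * Y')) ^ 2).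
    - unfold w', N; ring.
    - rewrite Hq', Hl'; ring. }
  assert (HN : t ^ 2 <= N).
  { assert (N * (x ^ 2 + y ^ 2) - t ^ 2 = (x * y * (1 - D)) ^ 2) by (unfold N, t; ring).
    rewrite Hp in H; pose proof (pow2_ge_0 (x * y * (1 - D))); lra. }
  assert (HN0 : 0 < N) by nra.
  (* Here [N] times the cross product is [g * C + t * w]. If [e * w <= 0], positivity makes
     [(g * C)^2] exceed [(t * w)^2], that is [t^2 < C^2], against [C^2 < D^2 <= t^2]. *)
  assert (Hew : 0 < e * w).
  { apply Rnot_le_lt; intros h.
    pose (g := x * (D * y) - y * x).
    assert (Hg : g ^ 2 = N - t ^ 2).
    { transitivity (N * (x ^ 2 + y ^ 2) - t ^ 2); [ unfold g, N, t; ring | rewrite Hp; ring ]. }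
    assert (E : N * (x * Y - y * X) = g * C + t * w).
    { rewrite <- Hl; unfold N, g, t, w; ring. }
    assert (H1 : 0 < N * (e * (x * Y - y * X))) by (apply Rmult_lt_0_compat; assumption).
    replace (N * (e * (x * Y - y * X))) with (e * (N * (x * Y - y * X))) in H1 by ring.
    rewrite E in H1.
    assert (H2 : 0 <= t * - (e * w)) by (apply Rmult_le_pos; lra).
    assert (H3 : (t * - (e * w)) ^ 2 < (e * (g * C)) ^ 2).
    { nra. }
    replace ((t * - (e * w)) ^ 2) with (e ^ 2 * (t ^ 2 * w ^ 2)) in H3 by ring.
    replace ((e * (g * C)) ^ 2) with (e ^ 2 * (g ^ 2 * C ^ 2)) in H3 by ring.
    rewrite He, Hw, Hg in H3; nra. }
  assert (E : w = w').
  { assert (H : (e * w + e * w') * (w - w') = 0)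
      by (transitivity (e * (w ^ 2 - w' ^ 2)); [ ring | rewrite Hw, Hw'; ring ]).
    apply Rmult_integral in H; lra. }
  (* A point is recovered from its inner product [C] and its cross product [w] with the vector
     [(x, D * y)], of squared length [N]. *)
  split; apply (Rmult_eq_reg_l N); try lra.
  - transitivity (x * C - D * y * w).
    + rewrite <- Hl; unfold N, w; ring.
    + rewrite E, <- Hl'; unfold N, w'; ring.
  - transitivity (D * y * C + x * w).
    + rewrite <- Hl; unfold N, w; ring.
    + rewrite E, <- Hl'; unfold N, w'; ring.
Qed.

(** [V] is chosen before the polygon, which expresses constancy in the family; [e] is the sign of
    the rotational sense. *)
Lemma normalised_cos_sum (n k : nat) (C D e : R) :
  0 < D <= 1 -> C ^ 2 < D ^ 2 -> e ^ 2 = 1 ->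
  exists V, forall p : nat -> pt,
    (forall i, p (i + n)%nat = p i) ->
    (forall i, dot (p i) (p i) = 1) ->
    (forall i, fst (p i) * fst (p (S i)) + D * (snd (p i) * snd (p (S i))) = C) ->
    (forall i, 0 < e * cross (p i) (p (S i))) ->
    rsum n (fun i => dot (p i) (p (i + k)%nat)) = V.
Proof.
  intros HD HC He.
  assert (HC1 : 0 < 1 - C ^ 2) by nra.
  pose (m := (1 - D ^ 2) / (1 - C ^ 2)).
  assert (Hm : m * (1 - C ^ 2) = 1 - D ^ 2) by (unfold m; field; lra).
  (* The two bounds on [m] come from [D <= 1] and [C^2 < D^2]. *)
  assert (m_ge0 : 0 <= m) by nra.
  assert (m_lt1 : m < 1) by nra.
  destruct (jacobi_exists m m_ge0 m_lt1) as (sn & cn & dn & eps & J).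
  pose proof (cn_sqr _ _ _ _ _ J) as csq.
  pose proof (dn_sqr _ _ _ _ _ J) as dsq.
  pose proof (dn_pos _ _ _ _ _ J) as dpos.
  pose proof (sqrt_lt_R0 _ HC1) as Hr.
  pose proof (pow2_sqrt (1 - C ^ 2) ltac:(lra)) as Hr2.
  (* The sign of [sn sg] is [e], so a step by [sg] turns in the sense of the polygon. *)
  destruct (jacobi_surj _ _ _ _ _ J C (e * sqrt (1 - C ^ 2))) as (sg & cs & ss).
  { rewrite Rpow_mult_distr, He, Hr2; ring. }
  assert (ds : dn sg = D).
  { pose proof (dpos sg); pose proof (dsq sg) as H1.
    rewrite ss, Rpow_mult_distr, He, Hr2 in H1; nra. }
  pose (s := INR k * sg).
  exists (INR n * cn s
          + (1 - dn s) * ((INR n * eps s - INR k * eps (INR n * sg)) / (m * sn s))).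
  intros p Hper Hunit Hbil Hsense.
  destruct (jacobi_surj _ _ _ _ _ J (fst (p 0%nat)) (snd (p 0%nat))) as (z0 & hc & hs).
  { rewrite <- (Hunit 0%nat); unfold dot; ring. }
  pose (z i := z0 + INR i * sg).
  assert (zS : forall i j, z (i + j)%nat = z i + INR j * sg).
  { intros i j; unfold z; rewrite plus_INR; ring. }
  assert (P : forall i, fst (p i) = cn (z i) /\ snd (p i) = sn (z i)).
  { induction i as [|i [IHc IHs]].
    - unfold z; simpl; rewrite Rmult_0_l, Rplus_0_r; auto.
    - pose proof (zS i 1%nat) as zi; rewrite Nat.add_1_r, Rmult_1_l in zi; rewrite zi.
      pose proof (jacobi_bilinear m sn cn dn eps m_ge0 m_lt1 J sg (z i)) as B1.
      pose proof (jacobi_cross m sn cn dn eps m_ge0 m_lt1 J sg (z i)) as B2.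
      rewrite cs, ds in B1; rewrite ds, ss in B2.
      pose proof (Hbil i) as h1; pose proof (Hsense i) as h2.
      pose proof (Hunit i) as h3; pose proof (Hunit (S i)) as h4.
      unfold cross, dot in *; rewrite IHc, IHs in *.
      eapply (half_circle_unique C D e (cn (z i)) (sn (z i))); eauto; try lra.
      + rewrite csq; ring.
      + rewrite B2.
        replace (e * (dn (z i) * (e * sqrt (1 - C ^ 2))))
          with (e ^ 2 * (dn (z i) * sqrt (1 - C ^ 2))) by ring.
        rewrite He, Rmult_1_l; apply Rmult_lt_0_compat; auto. }
  pose (f i := sn (z i) * sn (z i + s)).
  assert (Hdot : forall i, dot (p i) (p (i + k)%nat) = cn s + (1 - dn s) * f i).
  { intros i; destruct (P i) as [e1 e2], (P (i + k)%nat) as [e3 e4].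
    unfold dot, f; rewrite e1, e2, e3, e4, zS.
    rewrite <- (jacobi_bilinear m sn cn dn eps m_ge0 m_lt1 J s (z i)); fold s; ring. }
  rewrite (rsum_ext n _ _ Hdot), rsum_affine.
  (* In the degenerate case [dn s = 1]: the factor [1 - dn s] vanishes, whatever value the quotient
     by zero takes. *)
  destruct (Req_dec (m * sn s) 0) as [h0 | h0].
  { assert (d1 : dn s = 1).
    { pose proof (dpos s); pose proof (dsq s) as H1.
      replace (m * sn s ^ 2) with (m * sn s * sn s) in H1 by ring.
      rewrite h0 in H1; nra. }
    rewrite d1; ring. }
  do 2 f_equal; apply (Rmult_eq_reg_l (m * sn s)); [ | assumption ].
  assert (Hsum : rsum n (fun i => m * sn s * f i + (eps (z (i + k)%nat) - eps (z i)))
                 = INR n * eps s).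
  { rewrite (rsum_ext n _ (fun i => eps s + 0 * f i)); [ rewrite rsum_affine; ring | ].
    intros i; unfold f; rewrite zS.
    rewrite (eps_diff m sn cn dn eps m_ge0 m_lt1 J s (z i)); fold s; ring. }
  rewrite rsum_plus, (rsum_shift_quasiperiodic n k (fun i => eps (z i)) (eps (INR n * sg))) in Hsum.
  - rewrite (rsum_ext n _ (fun i => 0 + m * sn s * f i)), rsum_affine in Hsum by (intros; ring).
    field_simplify; [ lra | ].
    split; intros h; apply h0; rewrite h; ring.
  (* Closure [p n = p 0] is the coincidence at [z0] that makes [INR n * sg] a period. *)
  - intros i; rewrite zS.
    apply (eps_period m sn cn dn eps m_ge0 m_lt1 J _ z0);
      pose proof (zS 0%nat n) as zn; unfold z at 2 in zn; simpl in zn;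
      rewrite Rmult_0_l, Rplus_0_r in zn; rewrite <- zn;
      destruct (P n) as [e1 e2]; rewrite <- ?e1, <- ?e2;
      pose proof (Hper 0%nat) as e0; simpl in e0; rewrite e0; auto.
Qed.

(** * Principal axes and the tangency condition *)

(** The vector [(a - c, 2 * b)] has twice the polar angle of the short axis [(e1, e2)]. The
    eigenvalues are positive because their sum [a + c] and product [a * c - b^2] are. *)
Lemma principal_axes (a b c : R) : is_ellipse_param a b c ->
  exists e1 e2 l m, e1 ^ 2 + e2 ^ 2 = 1 /\ 0 < m <= l /\
    a = l * e1 ^ 2 + m * e2 ^ 2 /\ b = (l - m) * (e1 * e2) /\ c = l * e2 ^ 2 + m * e1 ^ 2.
Proof.
  intros [Ha Hdet].
  assert (Hpos : 0 <= (a - c) ^ 2 + (2 * b) ^ 2)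
    by (pose proof (pow2_ge_0 (a - c)); pose proof (pow2_ge_0 (2 * b)); lra).
  pose (rho := sqrt ((a - c) ^ 2 + (2 * b) ^ 2)).
  assert (Hrho0 : 0 <= rho) by apply sqrt_pos.
  assert (Hrho : rho ^ 2 = (a - c) ^ 2 + (2 * b) ^ 2) by (apply pow2_sqrt, Hpos).
  assert (Ht : exists t, a - c = rho * cos (2 * t) /\ 2 * b = rho * sin (2 * t)).
  { destruct (Req_dec rho 0) as [h | h].
    - pose proof (pow2_ge_0 (a - c)); pose proof (pow2_ge_0 (2 * b)).
      rewrite h in Hrho; exists 0; rewrite h, !Rmult_0_l.
      split; apply Rsqr_0_uniq; unfold Rsqr; lra.
    - destruct (unit_polar ((a - c) / rho) (2 * b / rho)) as (t & hc & hs).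
      + replace (((a - c) / rho) ^ 2 + (2 * b / rho) ^ 2)
          with (((a - c) ^ 2 + (2 * b) ^ 2) / rho ^ 2) by (field; assumption).
        rewrite Hrho; field; rewrite <- Hrho; apply pow_nonzero, h.
      + exists (t / 2); replace (2 * (t / 2)) with t by field.
        rewrite hc, hs; split; field; assumption. }
  destruct Ht as (t & Hc & Hs); rewrite cos_2a in Hc; rewrite sin_2a in Hs.
  pose proof (sin2_cos2 t) as e; unfold Rsqr in e.
  exists (cos t), (sin t), ((a + c + rho) / 2), ((a + c - rho) / 2).
  assert (0 < c) by (pose proof (pow2_ge_0 b); nra).
  repeat split; nra.
Qed.

(** Lagrange's identity [q(X) q(d) = B(X,d)^2 + det * cross(X,d)^2] for the quadratic form [q] with
    polar form [B], at the point of contact [X], where [q(X) = 1] and [B(X,d) = 0]. *)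
Lemma tangent_chord (O p q : pt) (a b c : R) :
  is_ellipse_param a b c -> tangent_to_ellipse O a b c p q ->
  a * fst (vsub q p) ^ 2 + 2 * b * fst (vsub q p) * snd (vsub q p) + c * snd (vsub q p) ^ 2
  = (a * c - b ^ 2) * cross (vsub p O) (vsub q O) ^ 2.
Proof.
  intros [Ha Hdet] [Hpq [x [[Hx Hl] Huniq]]].
  destruct O as [o1 o2], p as [p1 p2], q as [q1 q2], x as [x1 x2].
  unfold on_ellipse, on_line, vsub, cross in *; simpl fst in *; simpl snd in *.
  set (d1 := q1 - p1) in *; set (d2 := q2 - p2) in *.
  pose (Q := a * d1 ^ 2 + 2 * b * d1 * d2 + c * d2 ^ 2).
  pose (X := x1 - o1); pose (Y := x2 - o2); fold X Y in Hx.
  pose (B := a * X * d1 + b * (X * d2 + Y * d1) + c * Y * d2).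
  assert (Hd : d1 <> 0 \/ d2 <> 0).
  { destruct (Req_dec d1 0) as [h1|]; [ | auto ].
    destruct (Req_dec d2 0) as [h2|]; [ | auto ].
    exfalso; apply Hpq; unfold d1, d2 in *; f_equal; lra. }
  assert (HQ : 0 < Q).
  { assert (E : a * Q = (a * d1 + b * d2) ^ 2 + (a * c - b ^ 2) * d2 ^ 2)
      by (unfold Q; ring).
    pose proof (pow2_ge_0 (a * d1 + b * d2)).
    destruct (Req_dec d2 0) as [h2 | h2].
    - destruct Hd as [h1|]; [ | easy ].
      unfold Q; rewrite h2; pose proof (pow2_gt_0 d1 h1); nra.
    - pose proof (pow2_gt_0 d2 h2); nra. }
  (* The second intersection of the line with the ellipse is the reflection below of the
     first one, so [B = 0]. *)
  assert (Hs : exists s, s * Q = 2 * B) by (exists (2 * B / Q); field; lra).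
  destruct Hs as [s Hs].
  assert (E : (x1, x2) = (x1 - s * d1, x2 - s * d2)).
  { apply Huniq; simpl; split.
    - transitivity (a * X ^ 2 + 2 * b * X * Y + c * Y ^ 2 - s * (2 * B) + s * (s * Q)).
      + unfold B, Q, X, Y; ring.
      + rewrite Hs, Hx; ring.
    - rewrite <- Hl; ring. }
  injection E as E1 E2.
  assert (HB : B = 0).
  { assert (s = 0).
    { destruct Hd as [h|h]; [ apply (Rmult_eq_reg_r d1) | apply (Rmult_eq_reg_r d2) ]; lra. }
    subst s; lra. }
  fold Q; transitivity ((a * X ^ 2 + 2 * b * X * Y + c * Y ^ 2) * Q); [ rewrite Hx; ring | ].
  transitivity (B ^ 2 + (a * c - b ^ 2) * (X * d2 - Y * d1) ^ 2); [ unfold B, Q; ring | ].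
  rewrite HB.
  replace (X * d2 - Y * d1) with ((p1 - o1) * (q2 - o2) - (p2 - o2) * (q1 - o1)
      - (d1 * (x2 - p2) - d2 * (x1 - p1))) by (unfold X, Y, d1, d2; ring).
  rewrite Hl; ring.
Qed.

(** On the unit circle both sides of the tangency equation contain the factor [1 - (x * X + y * Y)],
    nonzero here; cancelling it leaves a bilinear relation. *)
Lemma chord_bilinear (L M x y X Y : R) :
  x ^ 2 + y ^ 2 = 1 -> X ^ 2 + Y ^ 2 = 1 -> x * Y - y * X <> 0 ->
  L * (X - x) ^ 2 + M * (Y - y) ^ 2 = L * M * (x * Y - y * X) ^ 2 ->
  (L * M - M + L) * (x * X) + (L * M + M - L) * (y * Y) = L + M - L * M.
Proof.
  intros Hp Hq Hc H.
  assert (H1 : (x * Y - y * X) ^ 2 = (1 - (x * X + y * Y)) * (1 + (x * X + y * Y))).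
  { transitivity ((x ^ 2 + y ^ 2) * (X ^ 2 + Y ^ 2) - (x * X + y * Y) ^ 2); [ ring | ].
    rewrite Hp, Hq; ring. }
  assert (H0 : 1 - (x * X + y * Y) <> 0).
  { intros h; rewrite h, Rmult_0_l in H1; apply (pow_nonzero _ 2) in Hc; easy. }
  assert (Ey : y ^ 2 = 1 - x ^ 2) by lra.
  assert (EY : Y ^ 2 = 1 - X ^ 2) by lra.
  assert (H2 : (X - x) ^ 2 = (1 - (x * X + y * Y)) * (1 - (x * X - y * Y))) by ring [Ey EY].
  assert (H3 : (Y - y) ^ 2 = (1 - (x * X + y * Y)) * (1 + (x * X - y * Y))) by ring [Ey EY].
  rewrite H1, H2, H3 in H.
  assert (H4 : L * (1 - (x * X - y * Y)) + M * (1 + (x * X - y * Y))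
               = L * M * (1 + (x * X + y * Y))).
  { apply (Rmult_eq_reg_l _ _ _ ) with (2 := H0); rewrite <- (Rmult_assoc _ (L * M)).
    lra. }
  lra.
Qed.

(** * Passage to normalised coordinates and comparison of two polygons *)

(** A rotation to the principal axes, scaled by [1 / r]; for [r > 0] it preserves angles and
    orientation. *)
Definition axes_coord (O : pt) (r e1 e2 : R) (u : pt) : pt :=
  let U := vsub u O in
  ((e1 * fst U + e2 * snd U) / r, (e1 * snd U - e2 * fst U) / r).

Lemma axes_coord_dot (O : pt) (r e1 e2 : R) (u v : pt) :
  r <> 0 -> e1 ^ 2 + e2 ^ 2 = 1 ->
  dot (axes_coord O r e1 e2 u) (axes_coord O r e1 e2 v) = dot (vsub u O) (vsub v O) / r ^ 2.
Proof.
  intros Hr He.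
  transitivity ((e1 ^ 2 + e2 ^ 2) * dot (vsub u O) (vsub v O) / r ^ 2).
  - unfold axes_coord, dot; simpl; field; assumption.
  - rewrite He; field; assumption.
Qed.

Lemma axes_coord_cross (O : pt) (r e1 e2 : R) (u v : pt) :
  r <> 0 -> e1 ^ 2 + e2 ^ 2 = 1 ->
  cross (axes_coord O r e1 e2 u) (axes_coord O r e1 e2 v)
  = cross (vsub u O) (vsub v O) / r ^ 2.
Proof.
  intros Hr He.
  transitivity ((e1 ^ 2 + e2 ^ 2) * cross (vsub u O) (vsub v O) / r ^ 2).
  - unfold axes_coord, cross; simpl; field; assumption.
  - rewrite He; field; assumption.
Qed.

(** By Cauchy-Schwarz the quotient lies in [[-1, 1]], where [cos] undoes [acos]. *)
Lemma cos_angle (O p q : pt) (r : R) :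
  0 < r -> on_circle O r p -> on_circle O r q ->
  cos (angle p O q) = dot (vsub p O) (vsub q O) / r ^ 2.
Proof.
  intros Hr Hp Hq; unfold angle, vnorm, on_circle in *.
  rewrite Hp, Hq, sqrt_pow2 by lra.
  replace (r * r) with (r ^ 2) by ring.
  apply cos_acos.
  assert (Hr2 : 0 < r ^ 2) by (apply pow_lt, Hr).
  set (P := vsub p O) in *; set (Q := vsub q O) in *; unfold dot in *.
  pose proof (pow2_ge_0 (fst P - fst Q)); pose proof (pow2_ge_0 (snd P - snd Q)).
  pose proof (pow2_ge_0 (fst P + fst Q)); pose proof (pow2_ge_0 (snd P + snd Q)).
  split; apply (Rmult_le_reg_r (r ^ 2)); try assumption;
    unfold Rdiv; rewrite ?Rmult_assoc, Rinv_l, Rmult_1_r by lra; nra.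
Qed.

(* The Poncelet family of u consists of the Poncelet n-gons v for the same
   pair drawn in the same rotational sense (any starting point on the circle). *)
Theorem theorem6p2 (O : pt) (r a b c : R) (n k : nat) (u v : nat -> pt) :
  0 < r ->
  is_ellipse_param a b c ->
  ellipse_inside_circle O r a b c ->
  poncelet_ngon n O r a b c u ->
  poncelet_ngon n O r a b c v ->
  same_sense O u v ->
  cos_sum n k O u = cos_sum n k O v.
Proof.
  intros Hr Hell Hin Hu Hv Hsense.
  destruct (principal_axes a b c Hell) as (e1 & e2 & l & m & He & Hml & Ea & Eb & Ec).
  assert (Hr0 : r <> 0) by lra.
  assert (Hr2 : 0 < r ^ 2) by (apply pow_lt, Hr).
  assert (Hm : 1 < m * r ^ 2).
  { pose proof (sqrt_lt_R0 m ltac:(lra)) as Hsm.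
    pose proof (pow2_sqrt m ltac:(lra)) as Hsm2.
    (* The test point is an end of the long axis, at distance [1 / sqrt m] from [O]. *)
    assert (h := Hin (fst O - e2 / sqrt m, snd O + e1 / sqrt m)).
    assert (Ed : dot (vsub (fst O - e2 / sqrt m, snd O + e1 / sqrt m) O)
               (vsub (fst O - e2 / sqrt m, snd O + e1 / sqrt m) O) = / m).
    { transitivity ((e1 ^ 2 + e2 ^ 2) / sqrt m ^ 2).
      - unfold dot, vsub; simpl; field; lra.
      - rewrite He, Hsm2; field; lra. }
    rewrite Ed in h.
    apply (Rmult_lt_reg_l (/ m)); [ apply Rinv_0_lt_compat; lra | ].
    rewrite <- Rmult_assoc, Rinv_l, Rmult_1_r, Rmult_1_l by lra.
    apply h; unfold on_ellipse, vsub; simpl fst; simpl snd.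
    transitivity (m * (e1 ^ 2 + e2 ^ 2) ^ 2 / sqrt m ^ 2).
    - rewrite Ea, Eb, Ec; field; lra.
    - rewrite He, Hsm2; field; lra. }
  (* [1/L] and [1/M] are the squares of the semi-axes, the radius being the unit. *)
  pose (L := l * r ^ 2); pose (M := m * r ^ 2).
  assert (HM : 1 < M) by exact Hm.
  assert (HL : M <= L) by (unfold L, M; apply Rmult_le_compat_r; lra).
  assert (HK : 0 < L * M - M + L) by nra.
  (* The coefficients of [chord_bilinear], divided by that of [x * X]. *)
  pose (D := (L * M + M - L) / (L * M - M + L)).
  pose (C := (L + M - L * M) / (L * M - M + L)).
  assert (HD : D * (L * M - M + L) = L * M + M - L) by (unfold D; field; lra).
  assert (HC : C * (L * M - M + L) = L + M - L * M) by (unfold C; field; lra).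
  assert (HD1 : 0 < D <= 1) by nra.
  assert (HCD : C ^ 2 < D ^ 2).
  (* After clearing denominators the two inequalities read [M > 1] and [M > 0]. *)
  { assert (C < D) by nra.
    assert (- C < D) by nra.
    nra. }
  assert (Hsign : exists e, e ^ 2 = 1 /\ (forall i, 0 < e * side_sense O u i)
                                     /\ (forall i, 0 < e * side_sense O v i)).
  { destruct Hsense as [[h1 h2] | [h1 h2]]; [ exists 1 | exists (-1) ];
      repeat split; try ring; intros i; specialize (h1 i); specialize (h2 i); lra. }
  destruct Hsign as (e & He1 & Hsu & Hsv).
  destruct (normalised_cos_sum n k C D e HD1 HCD He1) as (V & HV).
  assert (main : forall w, poncelet_ngon n O r a b c w ->
            (forall i, 0 < e * side_sense O w i) -> cos_sum n k O w = V).
  { intros w (Hper & Hcirc & Htan) Hs.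
    pose (p i := axes_coord O r e1 e2 (w i)).
    assert (Hunit : forall i, dot (p i) (p i) = 1).
    { intros i; unfold p; rewrite axes_coord_dot by assumption.
      rewrite (Hcirc i); field; assumption. }
    assert (Hcr : forall i, cross (p i) (p (S i)) = side_sense O w i / r ^ 2).
    { intros i; apply axes_coord_cross; assumption. }
    rewrite <- (HV p).
    - apply rsum_ext; intros i; unfold p.
      rewrite (cos_angle _ _ _ r), axes_coord_dot by auto; reflexivity.
    - intros i; unfold p; rewrite Hper; reflexivity.
    - exact Hunit.
    - intros i.
      apply (Rmult_eq_reg_l (L * M - M + L)); [ | lra ].
      rewrite (Rmult_comm _ C), HC.
      rewrite <- (chord_bilinear L M (fst (p i)) (snd (p i)) (fst (p (S i))) (snd (p (S i)))).
      + rewrite <- HD; ring.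
      + rewrite <- (Hunit i); unfold dot; ring.
      + rewrite <- (Hunit (S i)); unfold dot; ring.
      + intros h; specialize (Hs i); specialize (Hcr i); unfold cross in Hcr.
        rewrite h in Hcr.
        replace (side_sense O w i) with (side_sense O w i / r ^ 2 * r ^ 2) in Hs by (field; lra).
        rewrite <- Hcr in Hs; lra.
      + specialize (Hcr i).
        unfold cross at 1 in Hcr; rewrite Hcr.
        pose proof (tangent_chord O (w i) (w (S i)) a b c Hell (Htan i)) as T.
        fold (side_sense O w i) in T.
        assert (Edet : a * c - b ^ 2 = l * m).
        { transitivity (l * m * (e1 ^ 2 + e2 ^ 2) ^ 2);
            [ rewrite Ea, Eb, Ec | rewrite He ]; ring. }
        rewrite Edet in T.
        transitivity (l * m * side_sense O w i ^ 2); [ | unfold L, M; field; assumption ].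
        rewrite <- T, Ea, Eb, Ec; unfold L, M, p, axes_coord, vsub; simpl; field; assumption.
    - intros i; rewrite Hcr; unfold Rdiv; rewrite <- Rmult_assoc.
      apply Rmult_lt_0_compat; [ apply Hs | apply Rinv_0_lt_compat, Hr2 ]. }
  rewrite (main u), (main v); auto.
Qed.
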